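(* Let $\mathbf{A}\in\mathbb{R}^{m\times n}$ have nonzero rows, let $\eta$ be the batch size, and let the coupling $\mathbf{P}\mathbf{W}\mathbf{D}^{-2}=\frac{\alpha}{\|\mathbf{A}\|_F^2}\mathbf{I}$ hold with a scalar relaxation parameter $\alpha>0$. Consider the convergence rate guarantee $q=1-\frac1\gamma\cdot\frac{L(\alpha)}{\|\mathbf{A}\|_F^2}$ for the randomized sparse Kaczmarz method with averaging, where $$L(\alpha)=\alpha-\frac{\alpha}{2\eta}\left(\frac{\alpha}{\|\mathbf{A}\|_F^2}(\eta-1)\sigma_{\max}^2(\mathbf{A})+\sigma_{\max}(\mathbf{W})\right).$$ Then the relaxation parameter $\alpha^*$ and the constant $L(\alpha^* )$ which yield the fastest convergence rate guarantee (smallest $q$, i.e. largest $L$) are as follows. 1. General weights: if $\eta>\max(1,\sigma_{\max}(\mathbf{W})/2)$, then $$\alpha^*=\frac{\|\mathbf{A}\|_F^2}{\sigma_{\max}^2(\mathbf{A})(\eta-1)}\left(\eta-\frac{\sigma_{\max}(\mathbf{W})}{2}\right),\qquad L(\alpha^* )=\frac{\|\mathbf{A}\|_F^2}{8\sigma_{\max}^2(\mathbf{A})}\cdot\frac{(2\eta-\sigma_{\max}(\mathbf{W}))^2}{\eta(\eta-1)}.$$ 2. Uniform weights, i.e. $\mathbf{W}=\alpha\mathbf{I}$: $$\alpha^*=\frac{\eta}{1+(\eta-1)\frac{\sigma_{\max}^2(\mathbf{A})}{\|\mathbf{A}\|_F^2}},\qquad L(\alpha^* )=\frac{\eta}{2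+2(\eta-1)\frac{\sigma_{\max}^2(\mathbf{A})}{\|\mathbf{A}\|_F^2}}.$$
   Context: $\mathbf{P}=\mathrm{Diag}(p_1,\dots,p_m)$ is the diagonal matrix of row sampling probabilities, $\mathbf{W}=\mathrm{Diag}(w_1,\dots,w_m)$ the diagonal matrix of weights, $\mathbf{D}=\mathrm{Diag}(\|a_1\|_2,\dots,\|a_m\|_2)$ where $a_i^T$ are the rows of $\mathbf{A}$; $\eta\ge1$ is an integer; $\sigma_{\max}$ denotes the largest singular value and $\|\cdot\|_F$ the Frobenius norm. The method: for $b\in\mathrm{Range}(\mathbf{A})$ and $\lambda>0$, start with $x_0=x_0^*=0$; in step $k$ draw $\eta$ indices $\tau_k$ from $\{1,\dots,m\}$ independently with replacement, index $i$ having probability $p_i$, and set $x_{k+1}^*=x_k^*-\frac1\eta\sum_{i\in\tau_k}w_i\frac{\langle a_i,x_k\rangle-b_i}{\|a_i\|_2^2}a_i$, $x_{k+1}=S_\lambda(x_{k+1}^* )$, where $S_\lambda(x)=\max\{|x|-\lambda,0\}\cdot\mathrm{sign}(x)$ componentwise. The rate guarantee referred to: with $f(x)=\lambda\|x\|_1+\frac12\|x\|_2^2$, $\hat x$ the unique minimizer of $f$ subject to $\mathbf{A}x=b$, and the Bregman distance $D_f^{x^*}(x,y)=f(y)-f(x)-\langle x^*,y-x\rangle$ for $x^*\in\partial f(x)$, the guarantee (stated for $\eta>1$ and $0<\alpha<2\frac{(\eta-\frac12\sigma_{\max}(\mathbf{W}))\|\mathbf{A}\|_F^2}{\sigma_{\max}(\mathbf{A})^2(\eta-1)}$)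 is $\mathbb{E}[D_f^{x_{k+1}^*}(x_{k+1},\hat x)]\le q\cdot\mathbb{E}[D_f^{x_k^*}(x_k,\hat x)]$ with $q\in(0,1)$ as in the claim. Here $\gamma=\frac{1}{\tilde\sigma_{\min}^2(\mathbf{A})}\cdot\frac{|\hat x|_{\min}+2\lambda}{|\hat x|_{\min}}$, where $|\hat x|_{\min}$ is the smallest absolute value of a nonzero entry of $\hat x$ and $\tilde\sigma_{\min}(\mathbf{A})$ is the minimum of $\sigma_{\min}(\mathbf{A}_J)$, the smallest nonzero singular value of $\mathbf{A}_J$, over all nonzero submatrices $\mathbf{A}_J$ of $\mathbf{A}$ formed by a subset $J$ of the columns. *)

(* Defs.v *)
From mathcomp Require Import all_boot all_order all_algebra.
From mathcomp Require Import classical_sets reals.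

Set Implicit Arguments.
Unset Strict Implicit.
Unset Printing Implicit Defensive.

Import Order.TTheory GRing.Theory Num.Theory.

Local Open Scope classical_set_scope.
Local Open Scope ring_scope.

Section Norms.
Variable R : realType.

(* For a single row or column this is the Euclidean norm. *)
Definition frobenius (m n : nat) (B : 'M[R]_(m, n)) : R :=
  Num.sqrt (\sum_i \sum_j B i j ^+ 2).

Definition l1norm (n : nat) (x : 'cV[R]_n) : R := \sum_i `|x i 0|.

End Norms.

Section SingularValues.
Variable R : realType.

(* When n > m this set may contain 0 even if B has full rank; neither the
   largest element nor the nonzero elements are affected. *)
Definition singular_values (m n : nat) (B : 'M[R]_(m, n)) : set R :=
  [set s | 0 <= s /\ eigenvalue (B^T *m B) (s ^+ 2)].

(* The sup and infs below are over finite sets, so they are attained as soon as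
   the set is nonempty; on the empty set sup and inf are 0. *)
Definition sigma_max (m n : nat) (B : 'M[R]_(m, n)) : R :=
  sup (singular_values B).

Definition sigma_min (m n : nat) (B : 'M[R]_(m, n)) : R :=
  inf [set s | singular_values B s /\ s != 0].

Definition col_submx (m n : nat) (A : 'M[R]_(m, n)) (J : {set 'I_n}) :
    'M[R]_(m, #|J|) :=
  colsub (fun k : 'I_#|J| => enum_val k) A.

Definition tilde_sigma_min (m n : nat) (A : 'M[R]_(m, n)) : R :=
  inf [set sigma_min (col_submx A J) | J in [set J | col_submx A J != 0]].

End SingularValues.

Section SparseKaczmarz.
Variable R : realType.

Definition objective (n : nat) (lam : R) (x : 'cV[R]_n) : R :=
  lam * l1norm x + 2^-1 * frobenius x ^+ 2.

(* The objective is strongly convex, hence there is at most one minimizer. *)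
Definition is_solution (m n : nat) (A : 'M[R]_(m, n)) (b : 'cV[R]_m) (lam : R)
    (xhat : 'cV[R]_n) : Prop :=
  A *m xhat = b /\
  forall x, A *m x = b -> objective lam xhat <= objective lam x.

Definition abs_min (n : nat) (x : 'cV[R]_n) : R :=
  inf [set `|x i 0| | i in [set i | x i 0 != 0]].

Definition gamma (m n : nat) (A : 'M[R]_(m, n)) (lam : R) (xhat : 'cV[R]_n) : R :=
  (tilde_sigma_min A ^+ 2)^-1 * ((abs_min xhat + 2 * lam) / abs_min xhat).

Definition probability_vector (m : nat) (p : 'rV[R]_m) : Prop :=
  (forall i, 0 <= p 0 i) /\ \sum_i p 0 i = 1.

Definition row_norms (m n : nat) (A : 'M[R]_(m, n)) : 'M[R]_m :=
  diag_mx (\row_i frobenius (row i A)).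

Definition coupling (m n : nat) (A : 'M[R]_(m, n)) (P W : 'M[R]_m) (alpha : R) :
    Prop :=
  P *m W *m invmx (row_norms A *m row_norms A)
    = (alpha / frobenius A ^+ 2)%:M.

Definition rate_const (m n : nat) (A : 'M[R]_(m, n)) (eta : nat) (W : 'M[R]_m)
    (alpha : R) : R :=
  alpha - alpha / (2 * eta%:R) *
    (alpha / frobenius A ^+ 2 * (eta%:R - 1) * sigma_max A ^+ 2 + sigma_max W).

Definition rate (m n : nat) (A : 'M[R]_(m, n)) (lam : R) (xhat : 'cV[R]_n)
    (eta : nat) (W : 'M[R]_m) (alpha : R) : R :=
  1 - 1 / gamma A lam xhat * (rate_const A eta W alpha / frobenius A ^+ 2).

(* The range of alpha, for eta > 1, in which rate is known to be a contraction
   factor for the expected Bregman distance to xhat. *)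
Definition in_guarantee_range (m n : nat) (A : 'M[R]_(m, n)) (eta : nat)
    (W : 'M[R]_m) (alpha : R) : Prop :=
  0 < alpha /\
  alpha < 2 * ((eta%:R - 2^-1 * sigma_max W) * frobenius A ^+ 2
               / (sigma_max A ^+ 2 * (eta%:R - 1))).

End SparseKaczmarz.

Definition strict_argmax (R : realType) (D : set R) (F : R -> R) (a : R) : Prop :=
  D a /\ forall a', D a' -> a' != a -> F a' < F a.

Definition strict_argmin (R : realType) (D : set R) (F : R -> R) (a : R) : Prop :=
  D a /\ forall a', D a' -> a' != a -> F a < F a'.

(* Main.v *)
(* For fixed W, and also for W = a I, L is a quadratic polynomial in the
   relaxation parameter, so completing the square, L(a) = L(a0) - c (a - a0)^2,
   settles the optimization once c > 0 and gamma > 0.  Both follow from the Gram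
   matrix of a nonzero real matrix having a nonzero eigenvalue: this makes
   sigma_max positive, and also sigma_min and tilde_sigma_min, which are infima
   of finite sets of positive numbers. *)
Require Import Defs.
From mathcomp Require Import all_boot all_order all_algebra.
From mathcomp Require Import classical_sets reals.
From mathcomp Require Import complex polyrcf ring.

Set Implicit Arguments.
Unset Strict Implicit.
Unset Printing Implicit Defensive.

Import Order.TTheory GRing.Theory Num.Theory.

Local Open Scope classical_set_scope.
Local Open Scope ring_scope.

(** * Extrema of finite sets of reals *)

Section FiniteSets.
Variable R : realType.
Implicit Types (E : set R) (s : seq R).

(** The minimum of 1 and the positive members of [s] is a positive lower bound of [E]. *)
Lemma inf_gt0_finite E s :
  E !=set0 -> (forall x, E x -> x \in s) -> (forall x, E x -> 0 < x) ->
  0 < inf E.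
Proof.
move=> E0 Es Epos.
apply: (@lt_le_trans _ _ (\big[Num.min/1]_(x <- s | 0 < x) x)).
  exact: lt_bigmin.
by apply: (lb_le_inf E0) => x Ex; apply: ge_bigmin_seq; auto.
Qed.

Lemma sup_ge_finite E s x :
  (forall y, E y -> y \in s) -> E x -> x <= sup E.
Proof.
move=> Es Ex; apply: ub_le_sup => //.
(* [sup] is an upper bound only of a set bounded above; this sum is a crude bound. *)
exists (\sum_(y <- s) `|y|) => y /Es ys.
rewrite (big_rem y ys) /= (le_trans (ler_norm y))// lerDl.
exact: sumr_ge0.
Qed.

End FiniteSets.

(** * Gram matrices and positivity of singular values *)

Section SingularValues.
Variable R : realType.

Lemma mulmx_tr_gt0 k (v : 'rV[R]_k) : v != 0 -> 0 < (v *m v^T) 0 0.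
Proof.
move=> v0; rewrite lt_neqAle mxE; under eq_bigr do rewrite mxE -expr2.
rewrite sumr_ge0 ?andbT; last by move=> i _; exact: sqr_ge0.
rewrite eq_sym psumr_neq0; last by move=> i _; exact: sqr_ge0.
have /rV0Pn[i vi] := v0; apply/hasP; exists i; first exact: mem_index_enum.
by rewrite /= lt_neqAle eq_sym sqrf_eq0 vi sqr_ge0.
Qed.

(** For a left eigenvector [v], both [mu |v|^2] and [|v B^T|^2] equal [v B^T B v^T]. *)
Lemma eigenvalue_gram_ge0 k l (B : 'M[R]_(k, l)) mu :
  eigenvalue (B^T *m B) mu -> 0 <= mu.
Proof.
move=> /eigenvalueP[v vB v0].
have BvE : v *m (B^T *m B) *m v^T = (v *m B^T) *m (v *m B^T)^T.
  by rewrite trmx_mul trmxK !mulmxA.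
rewrite -(pmulr_lge0 _ (mulmx_tr_gt0 v0)).
have -> : mu * (v *m v^T) 0 0 = (v *m (B^T *m B) *m v^T) 0 0.
  by rewrite vB -scalemxAl [RHS]mxE.
by rewrite BvE mxE sumr_ge0// => i _; rewrite !mxE -expr2 sqr_ge0.
Qed.

(** The diagonal of the Gram matrix holds the squared norms of the columns of [B]. *)
Lemma gram_eq0 k l (B : 'M[R]_(k, l)) : B^T *m B = 0 -> B = 0.
Proof.
move=> BB; apply/eqP; apply: contraTT isT => /matrix0Pn[i [j Bij]].
have : row j B^T != 0 by apply/rV0Pn; exists i; rewrite !mxE.
move=> /mulmx_tr_gt0; rewrite mxE.
have /matrixP/(_ j j) := BB; rewrite !mxE => BBj.
rewrite (eq_bigr (fun i => B^T j i * B i j)) ?BBj ?ltxx// => i' _.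
by rewrite !mxE.
Qed.

(* Over R[i] the real symmetric matrix M is diagonalizable with real
   eigenvalues, which cannot all vanish. *)
Lemma symmetric_eigenvalue_neq0 k (M : 'M[R]_k) :
  M^T = M -> M != 0 -> exists2 mu, mu != 0 & eigenvalue M mu.
Proof.
move=> MT M0; pose MC := map_mx (real_complex R) M.
have Mherm : MC \is hermsymmx.
  apply: realsym_hermsym.
    apply/is_hermitianmxP; rewrite expr0 scale1r map_mx_id//.
    by apply/matrixP => i j; rewrite !mxE -[in LHS]MT mxE.
  by apply/mxOverP => i j; rewrite mxE; apply/complex_realP; eexists.
have dreal := hermitian_spectral_diag_real Mherm.
have /hermitian_normalmx/orthomx_spectralP := Mherm.
have := spectral_unit MC.
set P := spectralmx MC; set d := spectral_diag MC in dreal * => Pu MCE.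
have [i di] : exists i, d 0 i != 0.
  apply/rV0Pn; apply: contra_neq M0 => d0.
  apply/eqP; rewrite -(map_mx_eq0 (real_complex R)).
  by rewrite -/MC MCE d0 linear0 mulmx0 mul0mx.
have /complex_realP[mu dE] := mxOverP dreal 0 i.
exists mu; first by apply: contra_neq di => mu0; rewrite dE mu0.
suff : eigenvalue MC (d 0 i) by rewrite dE (eigenvalue_map (real_complex R)).
(* In [MC = P^-1 diag(d) P] the rows of [P] are left eigenvectors, nonzero because [P] is
   invertible. *)
apply/eigenvalueP; exists (row i P).
  rewrite {1}MCE rowE !mulmxA mulmxK// -(rowE _ (diag_mx d)) row_diag_mx.
  by rewrite -scalemxAl.
apply: contraTneq Pu => Pi0; rewrite -row_free_unit; apply/negP => Pfree.
have : delta_mx 0 i = 0 :> 'rV[R[i]]_k.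
  by apply: (row_free_inj Pfree); rewrite mul0mx -rowE.
by move=> /rowP/(_ i)/eqP; rewrite !mxE !eqxx oner_eq0.
Qed.

(** Singular values are roots of a nonzero polynomial: the characteristic polynomial of the Gram
    matrix composed with ['X^2]. *)
Lemma singular_values_finite k l (B : 'M[R]_(k, l)) :
  exists s : seq R, forall x, singular_values B x -> x \in s.
Proof.
pose q := char_poly (B^T *m B) \Po 'X^2.
have q0 : q != 0.
  rewrite comp_poly_eq0 ?size_polyXn//.
  exact: monic_neq0 (char_poly_monic _).
exists (rootsR q) => x [_]; rewrite eigenvalue_root_char => rx.
rewrite -(roots_on_rootsR q0) in_itv /=.
by rewrite /root horner_comp hornerXn.
Qed.

Lemma singular_value_gt0_ex k l (B : 'M[R]_(k, l)) :
  B != 0 -> exists2 s, singular_values B s & 0 < s.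
Proof.
move=> B0; have : B^T *m B != 0 by apply: contra_neq B0; exact: gram_eq0.
move=> /symmetric_eigenvalue_neq0[|mu mu0 ev]; first by rewrite trmx_mul trmxK.
have mu_ge0 := eigenvalue_gram_ge0 ev.
exists (Num.sqrt mu); last by rewrite sqrtr_gt0 lt_neqAle eq_sym mu0.
by split; rewrite ?sqrtr_ge0// sqr_sqrtr.
Qed.

Lemma sigma_max_gt0 k l (B : 'M[R]_(k, l)) : B != 0 -> 0 < sigma_max B.
Proof.
move=> /singular_value_gt0_ex[x Bx x0]; apply: (lt_le_trans x0).
by have [s sP] := singular_values_finite B; exact: sup_ge_finite sP Bx.
Qed.

Lemma sigma_min_gt0 k l (B : 'M[R]_(k, l)) : B != 0 -> 0 < sigma_min B.
Proof.
move=> /singular_value_gt0_ex[x Bx x0].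
have [s sP] := singular_values_finite B.
apply: (@inf_gt0_finite _ _ s); first by exists x; split; rewrite ?gt_eqF.
- by move=> y [/sP].
- by move=> y [[y0 _] yn0]; rewrite lt_neqAle eq_sym yn0.
Qed.

(** Used for uniform weights. For [k = 0] there are no eigenvalues and the [sup] would be 0, hence
    [0 < k]. *)
Lemma sigma_max_scalar k (a : R) :
  (0 < k)%N -> 0 <= a -> sigma_max (a%:M : 'M_k) = a.
Proof.
case: k => // k _ a0; rewrite /sigma_max.
rewrite (_ : singular_values _ = [set a]) ?sup1//.
rewrite /singular_values tr_scalar_mx -scalar_mxM -expr2.
apply/seteqP; split=> [x [x0 /eigenvalueP[v]]|x ->] /=.
  rewrite mul_mx_scalar => /eqP; rewrite -subr_eq0 -scalerBl scaler_eq0.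
  by case/orP=> [|/eqP->]; rewrite ?eqxx// subr_eq0 eqrXn2// => /eqP->.
split=> //; apply/eigenvalueP; exists (const_mx 1).
  by rewrite mul_mx_scalar.
by apply/rV0Pn; exists 0; rewrite mxE oner_eq0.
Qed.

Lemma tilde_sigma_min_gt0 k l (A : 'M[R]_(k, l)) :
  A != 0 -> 0 < tilde_sigma_min A.
Proof.
move=> A0.
apply: (@inf_gt0_finite _ _
  (codom (fun J : {set 'I_l} => sigma_min (col_submx A J)))).
- exists (sigma_min (col_submx A [set: 'I_l]%SET)), [set: 'I_l]%SET => //=.
  apply: contra_neq A0 => A0; apply/matrixP => i j.
  have /matrixP/(_ i (enum_rank_in (finset.in_setT j) j)) := A0.
  by rewrite !mxE enum_rankK_in.
- by move=> _ [J _ <-]; exact: codom_f.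
- by move=> _ [J AJ <-]; exact: sigma_min_gt0.
Qed.

End SingularValues.

(** * From the constant [L] to the rate [q] *)

Section Rates.
Variable R : realType.

Lemma abs_min_gt0 k (x : 'cV[R]_k) : x != 0 -> 0 < abs_min x.
Proof.
move=> x0; apply: (@inf_gt0_finite _ _ (codom (fun i => `|x i 0|))).
- have /cV0Pn[i xi] := x0; by exists `|x i 0|, i.
- by move=> _ [i _ <-]; exact: codom_f.
- by move=> _ [i xi <-]; rewrite normr_gt0.
Qed.

Lemma gamma_gt0 k l (A : 'M[R]_(k, l)) lam (x : 'cV[R]_l) :
  A != 0 -> 0 < lam -> x != 0 -> 0 < gamma A lam x.
Proof.
move=> /tilde_sigma_min_gt0 A0 lam0 /abs_min_gt0 x0.
by rewrite mulr_gt0 ?invr_gt0 ?exprn_gt0 ?divr_gt0 ?addr_gt0 ?mulr_gt0.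
Qed.

Lemma frobenius_gt0 k l (A : 'M[R]_(k, l)) : A != 0 -> 0 < frobenius A.
Proof.
case/matrix0Pn=> i [j Aij]; rewrite sqrtr_gt0.
rewrite (bigD1 i)//= (bigD1 j)//= -addrA ltr_pwDl//.
  by rewrite lt_neqAle eq_sym sqrf_eq0 Aij sqr_ge0.
by rewrite addr_ge0 ?sumr_ge0// => *; rewrite ?sumr_ge0// => *; exact: sqr_ge0.
Qed.

(** [q] is affine in [L] with negative slope. Letting [W] depend on the parameter covers both fixed
    and uniform weights. *)
Lemma strict_argmin_rate k l (A : 'M[R]_(k, l)) lam x eta (W : R -> 'M[R]_k)
    (D : set R) a :
  A != 0 -> 0 < lam -> x != 0 ->
  strict_argmax D (fun a => rate_const A eta (W a) a) a ->
  strict_argmin D (fun a => rate A lam x eta (W a) a) a.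
Proof.
move=> A0 lam0 x0 [Da amax]; split=> // a' Da' /(amax a' Da') lt_a'a.
rewrite /rate ltrD2l ltrN2 ltr_pM2l ?divr_gt0 ?gamma_gt0//.
by rewrite ltr_pM2r// invr_gt0 exprn_gt0// frobenius_gt0.
Qed.

Lemma strict_argmax_quadratic (D : set R) (F : R -> R) (c a : R) :
  0 < c -> D a -> (forall x, D x -> F x = F a - c * (x - a) ^+ 2) ->
  strict_argmax D F a.
Proof.
move=> c0 Da FE; split=> // x Dx xa; rewrite FE// ltrBlDr ltrDl.
by rewrite mulr_gt0// lt_neqAle eq_sym sqrf_eq0 subr_eq0 xa sqr_ge0.
Qed.

(** For [W = a I] both sides of the coupling are proportional to [a], so it constrains [P] alone. *)
Lemma coupling_scalar k l (A : 'M[R]_(k, l)) P (a a' : R) :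
  0 < a -> coupling A P a%:M a -> coupling A P a'%:M a'.
Proof.
rewrite /coupling !mul_mx_scalar -!scalemxAl => a0 E.
rewrite -[a' in LHS](divfK (lt0r_neq0 a0)) -scalerA E scale_scalar_mx.
by rewrite mulrA divfK// gt_eqF.
Qed.

End Rates.

(* Once P and W are given, the coupling determines alpha.  In the first part
   L is therefore optimized, as a function of its displayed argument, with W
   (hence sigma_max W) held fixed.  In the second part W = a I follows the
   relaxation parameter a, and all competing a satisfy the coupling with the
   same P.  The rate mentions |xhat|_min, whence the condition xhat != 0. *)
Theorem corollary4p9 (R : realType) (m n : nat) (A : 'M[R]_(m, n)) (eta : nat)
    (p w : 'rV[R]_m) (alpha : R) (lam : R) (b : 'cV[R]_m) (xhat : 'cV[R]_n) :
  (forall i : 'I_m, row i A != 0) ->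
  (1 <= eta)%N ->
  probability_vector p ->
  0 < alpha ->
  coupling A (diag_mx p) (diag_mx w) alpha ->
  0 < lam ->
  (exists x : 'cV[R]_n, b = A *m x) ->
  is_solution A b lam xhat ->
  (let W := diag_mx w in
   let astar := frobenius A ^+ 2 / (sigma_max A ^+ 2 * (eta%:R - 1))
                * (eta%:R - sigma_max W / 2) in
   Num.max 1 (sigma_max W / 2) < eta%:R ->
   [/\ strict_argmax [set a | 0 < a] (rate_const A eta W) astar,
       xhat != 0 ->
         strict_argmin [set a | 0 < a] (rate A lam xhat eta W) astar,
       in_guarantee_range A eta W astar &
       rate_const A eta W astar
         = frobenius A ^+ 2 / (8 * sigma_max A ^+ 2)
           * ((2 * eta%:R - sigma_max W) ^+ 2 / (eta%:R * (eta%:R - 1)))])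
  /\
  (let W := fun a : R => a%:M : 'M[R]_m in
   let dom := [set a : R | 0 < a /\ coupling A (diag_mx p) (W a) a] in
   let t := (eta%:R - 1) * (sigma_max A ^+ 2 / frobenius A ^+ 2) in
   let astar := eta%:R / (1 + t) in
   diag_mx w = W alpha ->
   [/\ strict_argmax dom (fun a => rate_const A eta (W a) a) astar,
       xhat != 0 ->
         strict_argmin dom (fun a => rate A lam xhat eta (W a) a) astar,
       (1 < eta)%N -> in_guarantee_range A eta (W astar) astar &
       rate_const A eta (W astar) astar = eta%:R / (2 + 2 * t)]).
Proof.
move=> Arow eta_ge1 [_ p1] alpha0 cpl lam0 _ _.
(* Without rows the probabilities would sum to 0 instead of 1. *)
have m0 : (0 < m)%N.
  rewrite lt0n; apply/eqP => m0; move: p1; subst m; rewrite big_ord0 => /eqP.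
  by rewrite eq_sym oner_eq0.
have A0 : A != 0.
  by apply: contra_neq (Arow (Ordinal m0)) => ->; rewrite row0.
have F0 := frobenius_gt0 A0; have s0 := sigma_max_gt0 A0.
have e0 : 0 < eta%:R :> R by rewrite ltr0n.
split=> [W astar|W dom t astar wE].
  rewrite gt_max => /andP[e1 We].
  have em1 : 0 < eta%:R - 1 :> R by rewrite subr_gt0.
  have astar0 : 0 < astar.
    by rewrite /astar mulr_gt0 ?divr_gt0 ?mulr_gt0 ?exprn_gt0 ?subr_gt0.
  have amax : strict_argmax [set a | 0 < a] (rate_const A eta W) astar.
    (* The constant is minus the coefficient of [a^2] in [L]. *)
    apply: (@strict_argmax_quadratic _ _ _
      ((eta%:R - 1) * sigma_max A ^+ 2 / (2 * eta%:R * frobenius A ^+ 2))) => //.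
      by rewrite divr_gt0 ?mulr_gt0 ?exprn_gt0.
    move=> x _; rewrite /rate_const /astar; field.
    by rewrite !gt_eqF.
  split=> //.
  - by move=> x0; exact: (@strict_argmin_rate _ _ _ _ _ _ _ (fun=> W)).
  (* [astar] is the midpoint of the guarantee range. *)
  - split=> //; rewrite [ltRHS](_ : _ = astar + astar) ?ltrDl//.
    by rewrite /astar; field; rewrite !gt_eqF.
  - rewrite /rate_const /astar; field.
    by rewrite !gt_eqF.
have t0 : 0 <= t.
  by rewrite mulr_ge0 ?subr_ge0 ?ler1n// divr_ge0 ?sqr_ge0.
have t1 : 0 < 1 + t by rewrite ltr_pwDl.
have astar0 : 0 < astar by rewrite divr_gt0.
(* Since [sigma_max (W a) = a], the weight term of [L] becomes quadratic too. *)
have rateE a : 0 < a ->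
    rate_const A eta (W a) a = a - a ^+ 2 * (1 + t) / (2 * eta%:R).
  move=> a0; rewrite /rate_const sigma_max_scalar// ?ltW// /t; field.
  by rewrite !gt_eqF.
have amax : strict_argmax dom (fun a => rate_const A eta (W a) a) astar.
  apply: (@strict_argmax_quadratic _ _ _ ((1 + t) / (2 * eta%:R))).
  - by rewrite divr_gt0 ?mulr_gt0.
  - by split=> //; move: cpl; rewrite wE; exact: coupling_scalar.
  - move=> a [a0 _]; rewrite !rateE// /astar; field.
    by rewrite !gt_eqF.
split=> //.
- by move=> x0; exact: strict_argmin_rate.
- move=> eta_gt1; split=> //; rewrite sigma_max_scalar ?ltW//.
  have em1 : 0 < eta%:R - 1 :> R by rewrite subr_gt0 ltr1n.
  have tgt0 : 0 < t by rewrite mulr_gt0 ?divr_gt0 ?exprn_gt0.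
  (* The upper end is [(2 eta - astar) / t], and [eta - astar = t astar]. *)
  rewrite [ltRHS](_ : _ = astar + eta%:R / t) ?ltrDl ?divr_gt0//.
  rewrite -[_ * _ / _]mulrA.
  have -> : frobenius A ^+ 2 / (sigma_max A ^+ 2 * (eta%:R - 1)) = t^-1.
    by rewrite /t; field; rewrite !gt_eqF.
  by rewrite /astar; field; rewrite !gt_eqF.
- have t2 : 0 < 2 + 2 * t by rewrite -[X in X + _]mulr1 -mulrDr mulr_gt0.
  rewrite rateE// /astar; field.
  by rewrite !gt_eqF.
Qed.
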